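(* Let $\mathcal{H}_k$ be a semi-analytic tridiagonal space corresponding to the orthonormal basis $\{f_n\}_{n\ge 0}$, where $f_n(z)=(a_n+b_nz)z^n$, $n\ge 0$. Then the shift $M_z$ on $\mathcal{H}_k$ is left-invertible if and only if $\{|a_n/a_{n+1}|\}_{n\ge 0}$ is bounded away from zero (that is, there is $\epsilon>0$ with $|a_n/a_{n+1}|>\epsilon$ for all $n\ge 0$), or equivalently, $\mathcal{H}_k$ is an analytic tridiagonal space.
   Context: $\mathbb{D}$ is the open unit disc, $\mathcal{O}(\mathbb{D})$ the space of analytic functions on $\mathbb{D}$. For a positive definite scalar kernel $k$ on $\mathbb{D}$, analytic in the first variable, $\mathcal{H}_k$ is its reproducing kernel Hilbert space of analytic functions, and the shift $M_z$ is $(M_zf)(w)=wf(w)$. A semi-analytic tridiagonal space is such an $\mathcal{H}_k$ with $\mathbb{C}[z]\subseteq\mathcal{H}_k\subseteq\mathcal{O}(\mathbb{D})$ for which there are complex scalars $\{a_n\}_{n\ge 0}$, $\{b_n\}_{n\ge 0}$ with $a_n\ne 0$ for all $n$, $\sup_{n}|a_n/a_{n+1}|<\infty$, $\limsup_{n}|b_n/a_{n+1}|<1$, and such that $f_n(z)=(a_n+b_nz)z^n$, $n\ge 0$, form an orthonormal basis of $\mathcal{H}_k$ (so $k(z,w)=\sum_{n\ge0}f_n(z)\overline{f_n(w)}$). These conditions ensure that $M_z$ is bounded on $\mathcal{H}_k$. It is an analytic tridiagonal space if in addition $\{|a_n/a_{n+1}|\}_{n\ge 0}$ is bounded away from zero.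 A bounded operator $T$ on a Hilbert space $\mathcal{H}$ is left-invertible if there is a bounded operator $X$ on $\mathcal{H}$ with $XT=I_{\mathcal{H}}$. *)

(* Defs.v *)
From Stdlib Require Import Reals.
From Coquelicot Require Import Coquelicot.

Set Implicit Arguments.

Open Scope R_scope.

(** * The open unit disc and analytic functions on it *)

Record unit_disc : Type := UnitDisc { disc_val :> C ; disc_lt1 : Cmod disc_val < 1 }.

Definition analytic (f : unit_disc -> C) : Prop :=
  forall z0 : unit_disc, exists (r : R) (c : nat -> C),
    0 < r /\
    forall z : unit_disc, Cmod (z - z0)%C < r ->
      is_pseries (K := C_AbsRing) (V := C_NormedModule) c (z - z0)%C (f z).

(** * Kernels and reproducing kernel Hilbert spaces *)

(* In the sense of Aronszajn: the Gram matrices [k (z_i) (z_j)] are positive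
   semidefinite. *)
Definition positive_definite (k : unit_disc -> unit_disc -> C) : Prop :=
  forall (n : nat) (z : nat -> unit_disc) (c : nat -> C),
    exists r : R, 0 <= r /\
      sum_n (G := C_AbelianMonoid) (fun i => sum_n (G := C_AbelianMonoid)
        (fun j => Cconj (c i) * c j * k (z i) (z j))%C n) n = RtoC r.

Definition analytic_fst (k : unit_disc -> unit_disc -> C) : Prop :=
  forall w : unit_disc, analytic (fun z => k z w).

(* The reproducing kernel Hilbert space of [k]. Its elements are functions on
   the disc: [eval] is the linear embedding into the space of all functions,
   and [eval_inj] says that an element is determined by its values. The inner
   product is linear in the first variable. *)
Record rkhs (k : unit_disc -> unit_disc -> C) : Type := Rkhs {
  rkhs_space :> CompleteNormedModule C_AbsRing ;
  inner : rkhs_space -> rkhs_space -> C ;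
  inner_plus_l : forall x y z : rkhs_space,
    inner (plus x y) z = (inner x z + inner y z)%C ;
  inner_scal_l : forall (c : C) (x y : rkhs_space),
    inner (scal c x) y = (c * inner x y)%C ;
  inner_conj : forall x y : rkhs_space, inner y x = Cconj (inner x y) ;
  inner_norm : forall x : rkhs_space, inner x x = RtoC (norm x ^ 2) ;
  eval : rkhs_space -> unit_disc -> C ;
  eval_plus : forall (x y : rkhs_space) (w : unit_disc),
    eval (plus x y) w = (eval x w + eval y w)%C ;
  eval_scal : forall (c : C) (x : rkhs_space) (w : unit_disc),
    eval (scal c x) w = (c * eval x w)%C ;
  eval_inj : forall x y : rkhs_space,
    (forall w : unit_disc, eval x w = eval y w) -> x = y ;
  kernel_at : unit_disc -> rkhs_space ;
  eval_kernel_at : forall w z : unit_disc, eval (kernel_at w) z = k z w ;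
  reproducing : forall (x : rkhs_space) (w : unit_disc),
    inner x (kernel_at w) = eval x w
}.

Arguments inner {k} r _ _.
Arguments eval {k} r _ _.

Definition contains_polynomials k (H : rkhs k) : Prop :=
  forall (N : nat) (c : nat -> C), exists p : H, forall w : unit_disc,
    eval H p w = sum_n (G := C_AbelianMonoid) (fun n => c n * w ^ n)%C N.

Definition orthonormal_basis k (H : rkhs k) (f : nat -> H) : Prop :=
  (forall n, inner H (f n) (f n) = RtoC 1) /\
  (forall m n, m <> n -> inner H (f m) (f n) = RtoC 0) /\
  (* the linear span is dense *)
  (forall (x : H) (eps : R), 0 < eps ->
     exists (N : nat) (c : nat -> C),
       norm (minus x (sum_n (fun n => scal (c n) (f n)) N)) < eps).

(** * Tridiagonal spaces *)

Definition bounded_away_from_zero (u : nat -> R) : Prop :=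
  exists eps : R, 0 < eps /\ forall n, u n > eps.

Definition semi_analytic_tridiagonal k (H : rkhs k) (a b : nat -> C) : Prop :=
  contains_polynomials H /\
  (forall x : H, analytic (eval H x)) /\
  (forall n, a n <> RtoC 0) /\
  Rbar_lt (Sup_seq (fun n => Finite (Cmod (a n / a (S n))))) p_infty /\
  Rbar_lt (LimSup_seq (fun n => Cmod (b n / a (S n)))) 1 /\
  exists f : nat -> H,
    (forall n w, eval H (f n) w = ((a n + b n * w) * w ^ n)%C) /\
    orthonormal_basis H f.

Definition analytic_tridiagonal k (H : rkhs k) (a b : nat -> C) : Prop :=
  semi_analytic_tridiagonal H a b /\
  bounded_away_from_zero (fun n => Cmod (a n / a (S n))).

Definition analytic_tridiagonal_space k (H : rkhs k) : Prop :=
  exists a b : nat -> C, analytic_tridiagonal H a b.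

(** * The shift *)

Definition is_shift k (H : rkhs k) (T : H -> H) : Prop :=
  forall (x : H) (w : unit_disc), eval H (T x) w = (w * eval H x w)%C.

(* [is_linear] is Coquelicot's predicate of bounded linear operators. *)
Definition left_invertible k (H : rkhs k) (T : H -> H) : Prop :=
  is_linear T /\ exists X : H -> H, is_linear X /\ forall x : H, X (T x) = x.

(* By [eval_inj] there is at most one [T] with [is_shift H T], namely M_z. *)
Definition shift_left_invertible k (H : rkhs k) : Prop :=
  exists T : H -> H, is_shift H T /\ left_invertible H T.

(* Main.v *)
Require Import Defs.
From Stdlib Require Import Reals Lra Lia FunctionalExtensionality.
From Coquelicot Require Import Coquelicot.

(** The idea is that, after a bounded change of coordinates, the shift is a
    weighted shift. Put [alpha n = a n / a (S n)] and
    [beta n = b n / a (S n)]. The monomials [e n = a n * z ^ n] satisfy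
    [f n = e n + beta n * e (S n)], so [c] are the coordinates of a function
    with respect to [f] exactly when [bidiag beta c] are its coordinates with
    respect to [e] ([taylor_series]). Since [limsup |beta n| < 1], both
    [bidiag beta] and its inverse [bidiag_inv beta] are bounded for the
    square-sum norm ([sqsum_operator_bidiag], [sqsum_operator_bidiag_inv]), that
    is, [e] is a Riesz basis. And [z * e n = alpha n * e (S n)]: on it, the
    shift is the weighted shift with weights [alpha].

    If [alpha] is bounded away from zero, the weighted backward shift with
    weights [1 / alpha n] is bounded and, carried back to the coordinates with
    respect to [f], gives the left inverse ([shift_left_invertible_sufficient]).
    Conversely, a left inverse [X] gives [e n = alpha n * X (e (S n))], and the
    norms of the [e n] lie between two positive constants, so [alpha] cannot
    approach zero ([shift_left_invertible_necessary]).

    The Hilbert space side is reduced to one identity, [norm_sqr_minus_sum], for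
    the distance between a vector and a combination of an orthonormal family:
    it yields Bessel's inequality, Parseval's identity, the best approximation
    property and hence the expansion of every vector, and the Riesz-Fischer
    theorem. They turn every operator on sequences that is bounded for the
    square-sum norm into a bounded operator on the space ([op]).

    The second equivalence follows from the first, applied to the scalars [a], [b]
    in one direction and, in the other, to those that witness that the space is
    analytic tridiagonal. *)

Set Implicit Arguments.
Open Scope R_scope.

(** * Series and bounds of sequences *)

Lemma is_series_norm {K : AbsRing} {V : NormedModule K} (u : nat -> V) (x : V) :
  is_series u x <->
  forall eps, 0 < eps -> exists N, forall n, (N <= n)%nat ->
    norm (minus x (sum_n u n)) < eps.
Proof.
split.
- intros Hx eps Heps.
  assert (Hd : 0 < eps / @norm_factor K V).
  { apply Rdiv_lt_0_compat; [assumption | apply norm_factor_gt_0]. }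
  destruct (proj1 (filterlim_locally _ _) Hx (mkposreal _ Hd)) as [N HN].
  exists N; intros n Hn.
  rewrite <- norm_opp, opp_minus.
  replace eps with (@norm_factor K V * mkposreal _ Hd)
    by (simpl; field; apply Rgt_not_eq, norm_factor_gt_0).
  now apply norm_compat2, HN.
- intros Hx; apply filterlim_locally; intros eps.
  destruct (Hx eps (cond_pos eps)) as [N HN].
  exists N; intros n Hn; apply norm_compat1.
  rewrite <- norm_opp, opp_minus; now apply HN.
Qed.

Lemma minus_plus_r {G : AbelianGroup} (x y z : G) :
  minus x (plus y z) = minus (minus x y) z.
Proof. unfold minus; now rewrite opp_plus, plus_assoc. Qed.

Lemma norm_le_minus {K : AbsRing} {V : NormedModule K} (x y : V) :
  norm x <= norm (minus x y) + norm y.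
Proof.
replace x with (plus (minus x y) y) at 1; [apply norm_triangle | ].
unfold minus; now rewrite <- plus_assoc, plus_opp_l, plus_zero_r.
Qed.

Lemma sum_n_S_R (u : nat -> R) n : sum_n u (S n) = sum_n u n + u (S n).
Proof. exact (sum_Sn u n). Qed.

Lemma sum_n_m_shift {G : AbelianMonoid} (u : nat -> G) n m :
  sum_n_m u n (n + m) = sum_n (fun i => u (n + i)%nat) m.
Proof.
induction m as [ | m IHm].
- now rewrite Nat.add_0_r, sum_n_n, sum_O, Nat.add_0_r.
- rewrite Nat.add_succ_r, sum_n_Sm, sum_Sn, IHm by lia.
  now rewrite Nat.add_succ_r.
Qed.

Lemma Sup_seq_bounded (u : nat -> R) :
  Rbar_lt (Sup_seq (fun n => Finite (u n))) p_infty -> exists M, forall n, u n <= M.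
Proof.
intros Hu.
assert (Hle : forall n, Rbar_le (u n) (Sup_seq (fun n => Finite (u n))))
  by (intros n; apply (Sup_seq_minor_le (fun n => Finite (u n)) (u n) n), Rbar_le_refl).
destruct (Sup_seq _) as [l | | ]; [now exists l | easy | destruct (Hle 0%nat)].
Qed.

Lemma LimSup_seq_lt (u : nat -> R) (l : R) :
  Rbar_lt (LimSup_seq u) l ->
  exists r N, r < l /\ forall n, (N <= n)%nat -> u n <= r.
Proof.
unfold LimSup_seq; destruct (ex_LimSup_seq u) as [[s | | ] Hs]; simpl; intros Hl.
- assert (He : 0 < (l - s) / 2) by lra.
  destruct (Hs (mkposreal _ He)) as [_ [N HN]]; simpl in HN.
  exists (s + (l - s) / 2), N; split; [lra | ].
  intros n Hn; apply Rlt_le, HN, Hn.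
- easy.
- destruct (Hs (l - 1)) as [N HN].
  exists (l - 1), N; split; [lra | ].
  intros n Hn; apply Rlt_le, HN, Hn.
Qed.

Lemma bounded_of_eventually (u : nat -> R) r N :
  (forall n, (N <= n)%nat -> u n <= r) -> exists M, forall n, u n <= M.
Proof.
revert r; induction N as [ | N IHN]; intros r Hu.
- exists r; intros n; apply Hu; lia.
- apply (IHN (Rmax r (u N))); intros n Hn.
  destruct (Nat.eq_dec n N) as [-> | Hne]; [apply Rmax_r | ].
  apply Rle_trans with (2 := Rmax_l _ _), Hu; lia.
Qed.

(** A convergent series is Cauchy, and one term is a block of length one. *)
Lemma is_series_term_small (u : nat -> C) (l : C) :
  is_series (V := C_NormedModule) u l ->
  forall eps, 0 < eps -> exists N, forall n, (N <= n)%nat -> Cmod (u n) < eps.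
Proof.
intros Hu eps Heps.
destruct (Cauchy_ex_series (V := C_CompleteNormedModule) u (ex_intro _ l Hu)
  (mkposreal _ Heps)) as [N HN].
exists N; intros n Hn; specialize (HN n n Hn Hn); rewrite sum_n_n in HN; exact HN.
Qed.

(** * Square-summable sequences and shift-like operators on them *)

(** The bound is on all partial sums, so that it makes sense, and can be proved
    by induction, before any convergence is known. *)
Definition sqsum_le (c : nat -> C) (B : R) : Prop :=
  forall N, sum_n (fun n => Cmod (c n) ^ 2) N <= B.

(** Bounded linear operators on the space of square-summable sequences, given by
    formulas that make sense for all sequences. *)
Definition sqsum_operator (A : (nat -> C) -> nat -> C) : Prop :=
  (forall c d n, A (fun i => c i + d i)%C n = (A c n + A d n)%C) /\
  (forall s c n, A (fun i => s * c i)%C n = (s * A c n)%C) /\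
  exists K, 0 < K /\ forall c B, sqsum_le c B -> sqsum_le (A c) (K * B).

Lemma sqsum_operator_comp (A B : (nat -> C) -> nat -> C) :
  sqsum_operator A -> sqsum_operator B -> sqsum_operator (fun c => A (B c)).
Proof.
intros [Aadd [Ascal [K [HK0 HK]]]] [Badd [Bscal [L [HL0 HL]]]].
split; [ | split].
- intros c d n; rewrite <- Aadd; f_equal.
  apply functional_extensionality; intros i; apply Badd.
- intros s c n; rewrite <- Ascal; f_equal.
  apply functional_extensionality; intros i; apply Bscal.
- exists (K * L); split; [now apply Rmult_lt_0_compat | ].
  intros c M Hc; rewrite Rmult_assoc; apply HK, HL, Hc.
Qed.

Definition weighted_shift (q : nat -> C) (c : nat -> C) (n : nat) : C :=
  match n with O => RtoC 0 | S m => (q m * c m)%C end.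

Definition weighted_backshift (q : nat -> C) (c : nat -> C) (n : nat) : C :=
  (q n * c (S n))%C.

Lemma sqsum_operator_weighted_shift (q : nat -> C) M :
  (forall n, Cmod (q n) <= M) -> sqsum_operator (weighted_shift q).
Proof.
intros Hq; split; [ | split].
- intros c d [ | n]; simpl; ring.
- intros s c [ | n]; simpl; ring.
- (* The summand [1] keeps the constant positive when [M = 0]. *)
  exists (M ^ 2 + 1); split; [assert (H := pow2_ge_0 M); lra | ].
  intros c B Hc N.
  assert (HS : forall m, sum_n (fun n => Cmod (weighted_shift q c n) ^ 2) m <=
    (M ^ 2 + 1) * sum_n (fun n => Cmod (c n) ^ 2) m
    - (M ^ 2 + 1) * Cmod (c m) ^ 2).
  { induction m as [ | m IHm].
    - rewrite !sum_O; cbn [weighted_shift]; rewrite Cmod_0; lra.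
    - rewrite !sum_n_S_R; cbn [weighted_shift].
      rewrite Cmod_mult, Rpow_mult_distr.
      assert (Hm : Cmod (q m) ^ 2 <= M ^ 2)
        by (apply pow_incr; split; [apply Cmod_ge_0 | apply Hq]).
      assert (Hcm := pow2_ge_0 (Cmod (c m))); nra. }
  specialize (HS N); specialize (Hc N).
  assert (HM := pow2_ge_0 M); assert (HcN := pow2_ge_0 (Cmod (c N))); nra.
Qed.

Lemma sqsum_operator_weighted_backshift (q : nat -> C) M :
  (forall n, Cmod (q n) <= M) -> sqsum_operator (weighted_backshift q).
Proof.
intros Hq; unfold weighted_backshift; split; [ | split].
- intros c d n; ring.
- intros s c n; ring.
- exists (M ^ 2 + 1); split; [assert (H := pow2_ge_0 M); lra | ].
  intros c B Hc N.
  assert (HS : forall m, sum_n (fun n => Cmod (q n * c (S n))%C ^ 2) m <=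
    (M ^ 2 + 1) * sum_n (fun n => Cmod (c n) ^ 2) (S m)).
  { assert (Hm : forall m, Cmod (q m * c (S m))%C ^ 2 <= (M ^ 2 + 1) * Cmod (c (S m)) ^ 2).
    { intros m; rewrite Cmod_mult, Rpow_mult_distr.
      apply Rmult_le_compat_r; [apply pow2_ge_0 | ].
      apply Rle_trans with (M ^ 2); [ | lra].
      apply pow_incr; split; [apply Cmod_ge_0 | apply Hq]. }
    induction m as [ | m IHm]; rewrite sum_n_S_R.
    - rewrite !sum_O.
      assert (H1 := Hm 0%nat); assert (H0 := pow2_ge_0 (Cmod (c 0%nat))).
      assert (HM := pow2_ge_0 M); nra.
    - rewrite (sum_n_S_R _ (S m)).
      assert (H1 := Hm (S m)); lra. }
  specialize (HS N); specialize (Hc (S N)).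
  assert (HM := pow2_ge_0 M); nra.
Qed.

Definition bidiag (q : nat -> C) (c : nat -> C) (n : nat) : C :=
  (c n + weighted_shift q c n)%C.

(** Forward substitution in the lower triangular system [bidiag q c = u]. *)
Fixpoint bidiag_inv (q : nat -> C) (u : nat -> C) (n : nat) : C :=
  match n with
  | O => u O
  | S m => (u (S m) - q m * bidiag_inv q u m)%C
  end.

Lemma bidiagK (q : nat -> C) (c : nat -> C) n : bidiag_inv q (bidiag q c) n = c n.
Proof.
induction n as [ | n IHn]; simpl; [ | rewrite IHn]; unfold bidiag; simpl; ring.
Qed.

Lemma bidiag_invK (q : nat -> C) (u : nat -> C) n : bidiag q (bidiag_inv q u) n = u n.
Proof. destruct n; unfold bidiag; simpl; ring. Qed.

(** Convexity of the square: [x + y] is the combination of [x / (1 - r)] and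
    [y / r] with weights [1 - r] and [r]. When [Cmod y] is at most [r * t], the
    last term is at most [r * t ^ 2], still a contraction. *)
Lemma Cmod_sqr_plus_le (x y : C) r : 0 < r < 1 ->
  Cmod (x + y)%C ^ 2 <= Cmod x ^ 2 / (1 - r) + Cmod y ^ 2 / r.
Proof.
intros Hr.
apply Rle_trans with ((Cmod x + Cmod y) ^ 2).
{ apply pow_incr; split; [apply Cmod_ge_0 | apply Cmod_triangle]. }
assert (Hd : Cmod x ^ 2 / (1 - r) + Cmod y ^ 2 / r - (Cmod x + Cmod y) ^ 2 =
  (r * Cmod x - (1 - r) * Cmod y) ^ 2 / (r * (1 - r))) by (field; lra).
assert (Hsq : 0 <= (r * Cmod x - (1 - r) * Cmod y) ^ 2 / (r * (1 - r))).
{ apply Rmult_le_pos; [apply pow2_ge_0 | ].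
  apply Rlt_le, Rinv_0_lt_compat; nra. }
lra.
Qed.

Lemma sqsum_operator_bidiag (q : nat -> C) M :
  (forall n, Cmod (q n) <= M) -> sqsum_operator (bidiag q).
Proof.
intros Hq; destruct (sqsum_operator_weighted_shift _ Hq) as [Hadd [Hscal [K [HK0 HK]]]].
unfold bidiag; split; [ | split].
- intros c d n; rewrite Hadd; ring.
- intros s c n; rewrite Hscal; ring.
- exists (2 * (1 + K)); split; [lra | ].
  intros c B Hc N; specialize (HK c B Hc N); specialize (Hc N).
  assert (HS : forall m, sum_n (fun n => Cmod (c n + weighted_shift q c n)%C ^ 2) m <=
     2 * sum_n (fun n => Cmod (c n) ^ 2) m +
     2 * sum_n (fun n => Cmod (weighted_shift q c n) ^ 2) m).
  { assert (Hm : forall m, Cmod (c m + weighted_shift q c m)%C ^ 2 <=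
      2 * Cmod (c m) ^ 2 + 2 * Cmod (weighted_shift q c m) ^ 2).
    { intros m; apply Rle_trans with (1 := Cmod_sqr_plus_le _ _ (r := / 2) ltac:(lra)).
      right; field. }
    induction m as [ | m IHm].
    - rewrite !sum_O; apply Hm.
    - rewrite !sum_n_S_R.
      specialize (Hm (S m)); lra. }
  specialize (HS N); lra.
Qed.

(** The least solution of the inequality is
    [p n = q n + q n * q (S n) + q n * q (S n) * q (S (S n)) + ...], which is
    bounded because the products decay geometrically. In a recursion
    [s (S n) <= h (S n) + q n * s n] the number [p n] is the total contribution
    of a unit amount present in [s n] to all later terms. *)
Lemma potential_exists (q : nat -> R) r Q N :
  0 < r < 1 -> (forall n, 0 <= q n <= Q) -> (forall n, (N <= n)%nat -> q n <= r) ->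
  exists (p : nat -> R) (P : R),
    forall n, 0 <= p n <= P /\ (1 + p (S n)) * q n <= p n.
Proof.
intros Hr; revert q; induction N as [ | N IHN]; intros q HQ Hq.
- exists (fun _ => r / (1 - r)), (r / (1 - r)); intros n.
  assert (Hp : 0 <= r / (1 - r))
    by (apply Rmult_le_pos; [lra | apply Rlt_le, Rinv_0_lt_compat; lra]).
  split; [lra | ].
  apply Rle_trans with ((1 + r / (1 - r)) * r); [ | right; field; lra].
  apply Rmult_le_compat_l; [lra | apply Hq; lia].
- destruct (IHN (fun n => q (S n))) as [p [P Hp]].
  + intros n; apply HQ.
  + intros n Hn; apply Hq; lia.
  + exists (fun n => match n with O => (1 + p 0%nat) * q 0%nat | S m => p m end).
    exists (Rmax P ((1 + p 0%nat) * q 0%nat)).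
    intros [ | n].
    * split; [split | lra].
      -- apply Rmult_le_pos; [assert (H := Hp 0%nat); lra | apply HQ].
      -- apply Rmax_r.
    * destruct (Hp n) as [[H1 H2] H3].
      split; [split; [exact H1 | now apply Rle_trans with (1 := H2), Rmax_l] | exact H3].
Qed.

(** Squaring the recursion that defines [v = bidiag_inv q u] gives
    [|v (S n)| ^ 2 <= |u (S n)| ^ 2 / (1 - r) + (|q n| ^ 2 / r) * |v n| ^ 2],
    where the last factor is at most [r] for large [n]. Adding to the
    partial sum of the [|v n| ^ 2] the amount [p n * |v n| ^ 2] that the last
    term still has to contribute makes the bound provable by induction. *)
Lemma sqsum_operator_bidiag_inv (q : nat -> C) M r N :
  (forall n, Cmod (q n) <= M) -> 0 < r < 1 ->
  (forall n, (N <= n)%nat -> Cmod (q n) <= r) -> sqsum_operator (bidiag_inv q).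
Proof.
intros HM Hr Hq; split; [ | split].
- intros c d n; induction n as [ | n IHn]; simpl; [ | rewrite IHn]; ring.
- intros s c n; induction n as [ | n IHn]; simpl; [ | rewrite IHn]; ring.
- destruct (@potential_exists (fun n => Cmod (q n) ^ 2 / r) r (M ^ 2 / r) N)
    as [p [P Hp]].
  + exact Hr.
  + intros n; split.
    * apply Rmult_le_pos; [apply pow2_ge_0 | apply Rlt_le, Rinv_0_lt_compat; lra].
    * apply Rmult_le_compat_r; [apply Rlt_le, Rinv_0_lt_compat; lra | ].
      apply pow_incr; split; [apply Cmod_ge_0 | apply HM].
  + intros n Hn; apply Rmult_le_reg_r with r; [lra | ].
    unfold Rdiv; rewrite Rmult_assoc, Rinv_l, Rmult_1_r by lra.
    replace (r * r) with (r ^ 2) by ring.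
    apply pow_incr; split; [apply Cmod_ge_0 | now apply Hq].
  + assert (HP : 0 <= P) by (destruct (Hp 0%nat); lra).
    assert (Hi : 0 < / (1 - r)) by (apply Rinv_0_lt_compat; lra).
    assert (Hi1 : 1 <= / (1 - r))
      by (rewrite <- Rinv_1 at 1; apply Rinv_le_contravar; lra).
    exists ((1 + P) * / (1 - r)); split; [apply Rmult_lt_0_compat; lra | ].
    intros u B Hu m.
    set (v := bidiag_inv q u).
    assert (HS : forall m, sum_n (fun n => Cmod (v n) ^ 2) m + p m * Cmod (v m) ^ 2 <=
      (1 + P) * / (1 - r) * sum_n (fun n => Cmod (u n) ^ 2) m).
    { clear m; induction m as [ | m IHm].
      - rewrite !sum_O; unfold v; simpl bidiag_inv.
        destruct (Hp 0%nat) as [Hp0 _].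
        assert (H := pow2_ge_0 (Cmod (u 0%nat))).
        assert (1 + p 0%nat <= (1 + P) * / (1 - r)) by nra.
        nra.
      - rewrite !sum_n_S_R.
        assert (Hv : Cmod (v (S m)) ^ 2 <=
          / (1 - r) * Cmod (u (S m)) ^ 2 + Cmod (q m) ^ 2 / r * Cmod (v m) ^ 2).
        { replace (v (S m)) with (u (S m) + - (q m * v m))%C by (unfold v; simpl; ring).
          apply Rle_trans with (1 := Cmod_sqr_plus_le _ _ Hr).
          rewrite Cmod_opp, Cmod_mult; right; field; lra. }
        destruct (Hp m) as [Hpm Hstep]; destruct (Hp (S m)) as [HpS _].
        assert (Hvm := pow2_ge_0 (Cmod (v m))).
        assert (Hum := pow2_ge_0 (Cmod (u (S m)))).
        assert (H1 : (1 + p (S m)) * Cmod (v (S m)) ^ 2 <=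
          (1 + p (S m)) * (/ (1 - r) * Cmod (u (S m)) ^ 2)
          + (1 + p (S m)) * (Cmod (q m) ^ 2 / r) * Cmod (v m) ^ 2).
        { rewrite Rmult_assoc, <- Rmult_plus_distr_l.
          apply Rmult_le_compat_l; [lra | exact Hv]. }
        assert (H2 : (1 + p (S m)) * (Cmod (q m) ^ 2 / r) * Cmod (v m) ^ 2 <=
          p m * Cmod (v m) ^ 2) by (apply Rmult_le_compat_r; assumption).
        assert (H3 : (1 + p (S m)) * (/ (1 - r) * Cmod (u (S m)) ^ 2) <=
          (1 + P) * (/ (1 - r) * Cmod (u (S m)) ^ 2)).
        { apply Rmult_le_compat_r; [ | lra]. apply Rmult_le_pos; lra. }
        lra. }
    destruct (Hp m) as [Hpm _].
    assert (Hvm := pow2_ge_0 (Cmod (v m))).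
    specialize (HS m); specialize (Hu m).
    assert (0 <= (1 + P) * / (1 - r)) by (apply Rmult_le_pos; lra).
    nra.
Qed.

Definition delta (m n : nat) : C := if Nat.eqb n m then RtoC 1 else RtoC 0.

Lemma sum_delta m n :
  sum_n (fun i => Cmod (delta m i) ^ 2) n = if Nat.leb m n then 1 else 0.
Proof.
unfold delta; induction n as [ | n IHn].
- rewrite sum_O; refine (_ : @eq R _ _).
  destruct m; simpl; [rewrite Cmod_1 | rewrite Cmod_0]; ring.
- rewrite sum_n_S_R, IHn; refine (_ : @eq R _ _).
  destruct (Nat.leb_spec m n), (Nat.leb_spec m (S n)), (Nat.eqb_spec (S n) m); try lia;
    (rewrite Cmod_1 || rewrite Cmod_0); ring.
Qed.

(** * Orthonormal expansions *)

Section Hilbert.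

Variables (k : unit_disc -> unit_disc -> C) (H : rkhs k).
Implicit Types x y z : H.

Lemma inner_plus_r x y z : inner H x (plus y z) = (inner H x y + inner H x z)%C.
Proof.
rewrite (inner_conj H (plus y z) x), inner_plus_l, Cplus_conj.
now rewrite <- !inner_conj.
Qed.

Lemma inner_scal_r (c : C) x y : inner H x (scal c y) = (Cconj c * inner H x y)%C.
Proof.
rewrite (inner_conj H (scal c y) x), inner_scal_l, Cmult_conj.
now rewrite <- inner_conj.
Qed.

Lemma inner_minus_l x y z : inner H (minus x y) z = (inner H x z - inner H y z)%C.
Proof.
unfold minus; rewrite inner_plus_l.
rewrite <- (scal_opp_one (V := NormedModule.ModuleSpace C_AbsRing H) y : _ = opp y).
rewrite inner_scal_l.
change (opp one) with (- RtoC 1)%C; ring.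
Qed.

Lemma inner_minus_r x y z : inner H x (minus y z) = (inner H x y - inner H x z)%C.
Proof.
rewrite (inner_conj H (minus y z) x), inner_minus_l, Cminus_conj.
now rewrite <- !inner_conj.
Qed.

Lemma norm_sqr_plus x y :
  norm (plus x y) ^ 2 = norm x ^ 2 + 2 * Re (inner H x y) + norm y ^ 2.
Proof.
apply RtoC_inj.
rewrite <- inner_norm, inner_plus_l, !inner_plus_r, !inner_norm.
rewrite (inner_conj H x y), !RtoC_plus, RtoC_mult, re_alt.
now field.
Qed.

Lemma norm_sqr_scal (c : C) x : norm (scal c x) ^ 2 = Cmod c ^ 2 * norm x ^ 2.
Proof.
apply RtoC_inj.
rewrite <- inner_norm, inner_scal_l, inner_scal_r, inner_norm.
rewrite RtoC_mult, Cmod2_conj; ring.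
Qed.

(** The square of the norm of [x - t * p * y], with [p = inner H x y], is a
    nonnegative quadratic polynomial in the real number [t]. *)
Lemma cauchy_schwarz x y : Cmod (inner H x y) <= norm x * norm y.
Proof.
set (p := inner H x y).
assert (Ht : forall t : R,
  0 <= norm x ^ 2 - 2 * t * Cmod p ^ 2 + t ^ 2 * Cmod p ^ 2 * norm y ^ 2).
{ intros t.
  assert (Hsq := pow2_ge_0 (norm (plus x (scal (- t * p)%C y)))).
  rewrite norm_sqr_plus, norm_sqr_scal, inner_scal_r in Hsq.
  fold p in Hsq.
  replace (Cconj (- t * p) * p)%C with (RtoC (- t * Cmod p ^ 2)) in Hsq.
  2: { rewrite RtoC_mult, RtoC_opp, Cmod2_conj, Cmult_conj, Copp_conj.
       unfold RtoC at 2, Cconj at 2; simpl; rewrite Ropp_0; fold (RtoC t).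
       now ring. }
  rewrite re_RtoC in Hsq.
  rewrite Cmod_mult, <- RtoC_opp, Cmod_R, Rpow_mult_distr, pow2_abs in Hsq.
  nra. }
assert (Hx := norm_ge_0 x); assert (Hy := norm_ge_0 y).
apply Rsqr_incr_0_var; [ | now apply Rmult_le_pos].
unfold Rsqr.
destruct (Req_dec (norm y) 0) as [Hy0 | Hy0].
- rewrite Hy0 in Ht |- *.
  destruct (Req_dec (Cmod p) 0) as [Hp0 | Hp0]; [rewrite Hp0; nra | exfalso].
  (* The polynomial is affine; at this [t] it takes the value [-1]. *)
  specialize (Ht ((norm x ^ 2 + 1) / (2 * Cmod p ^ 2))).
  replace (2 * ((norm x ^ 2 + 1) / (2 * Cmod p ^ 2)) * Cmod p ^ 2)
    with (norm x ^ 2 + 1) in Ht by now field.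
  nra.
- (* The minimum of the polynomial. *)
  specialize (Ht (/ norm y ^ 2)).
  replace (norm x ^ 2 - 2 * / norm y ^ 2 * Cmod p ^ 2
    + (/ norm y ^ 2) ^ 2 * Cmod p ^ 2 * norm y ^ 2)
    with ((norm x ^ 2 * norm y ^ 2 - Cmod p ^ 2) * / norm y ^ 2) in Ht
    by now field.
  assert (Hy2 : 0 < norm y ^ 2) by (apply pow_lt; lra).
  assert (0 <= norm x ^ 2 * norm y ^ 2 - Cmod p ^ 2); [ | nra].
  apply Rmult_le_reg_r with (/ norm y ^ 2); [now apply Rinv_0_lt_compat | lra].
Qed.

Lemma is_linear_inner y : is_linear (V := C_NormedModule) (fun x : H => inner H x y).
Proof.
split.
- intros; apply inner_plus_l.
- intros; apply inner_scal_l.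
- exists (norm y + 1); split; [assert (Hy := norm_ge_0 y); lra | ].
  intros x; apply Rle_trans with (norm x * norm y); [apply cauchy_schwarz | ].
  assert (Hx := norm_ge_0 x); lra.
Qed.

(** Point evaluation is the inner product with a kernel function, hence
    continuous: norm convergence implies pointwise convergence. *)
Lemma is_series_eval (u : nat -> H) x (w : unit_disc) :
  is_series u x ->
  is_series (V := C_NormedModule) (fun n => eval H (u n) w) (eval H x w).
Proof.
intros Hx.
unfold is_series; rewrite <- reproducing.
apply filterlim_ext with (fun n => inner H (sum_n u n) (kernel_at H w)).
{ induction x0 as [ | n IHn].
  - now rewrite !sum_O, reproducing.
  - now rewrite !sum_Sn, <- IHn, inner_plus_l, <- (reproducing H (u (S n))). }
apply (filterlim_comp _ _ _ (sum_n u) (fun x => inner H x (kernel_at H w)) _ (locally x)).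
- exact Hx.
- apply (linear_cont (V := C_NormedModule) (fun x => inner H x (kernel_at H w))).
  apply is_linear_inner.
Qed.

Definition orthonormal (f : nat -> H) : Prop :=
  (forall n, inner H (f n) (f n) = RtoC 1) /\
  (forall m n, m <> n -> inner H (f m) (f n) = RtoC 0).

(** Completing the square coordinate by coordinate; the distance is least
    exactly when the [c n] are the coordinates of [x]. *)
Lemma norm_sqr_minus_sum (f : nat -> H) (c : nat -> C) x N :
  orthonormal f ->
  norm (minus x (sum_n (fun n => scal (c n) (f n)) N)) ^ 2 =
  norm x ^ 2
  + sum_n (fun n => Cmod (c n - inner H x (f n))%C ^ 2 - Cmod (inner H x (f n)) ^ 2) N.
Proof.
intros [Hn Ho].
assert (Hstep : forall y m, norm (minus y (scal (c m) (f m))) ^ 2 = norm y ^ 2 +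
  (Cmod (c m - inner H y (f m))%C ^ 2 - Cmod (inner H y (f m)) ^ 2)).
{ intros y m; apply RtoC_inj.
  rewrite !RtoC_plus, RtoC_minus, !Cmod2_conj, <- !inner_norm.
  rewrite !inner_minus_l, !inner_minus_r, !inner_scal_l, !inner_scal_r, Hn.
  rewrite (inner_conj H y (f m)).
  rewrite !Cminus_conj; ring. }
induction N as [ | N IHN].
- rewrite !sum_O; apply Hstep.
- rewrite !sum_Sn.
  set (s := sum_n _ N) in *.
  replace (minus x (plus s (scal (c (S N)) (f (S N)))))
    with (minus (minus x s) (scal (c (S N)) (f (S N))))
    by (symmetry; exact (minus_plus_r (G := NormedModule.AbelianGroup C_AbsRing H) x s _)).
  rewrite Hstep, IHN.
  assert (Hs : inner H s (f (S N)) = RtoC 0).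
  { unfold s; clear - Ho.
    assert (G : forall M, (M <= N)%nat ->
       inner H (sum_n (fun n => scal (c n) (f n)) M) (f (S N)) = RtoC 0).
    { induction M as [ | M IHM]; intros HM.
      - rewrite sum_O, inner_scal_l, Ho by lia; ring.
      - rewrite sum_Sn, inner_plus_l, inner_scal_l, Ho, IHM by lia; ring. }
    now apply G. }
  replace (inner H (minus x s) (f (S N))) with (inner H x (f (S N))).
  + unfold plus; simpl; ring.
  + rewrite inner_minus_l, Hs; ring.
Qed.

Section Expansion.

Variable f : nat -> H.
Hypothesis Hf : orthonormal f.

Definition coef x n : C := inner H x (f n).

Lemma norm_sqr_minus_fourier x N :
  norm (minus x (sum_n (fun n => scal (coef x n) (f n)) N)) ^ 2 =
  norm x ^ 2 - sum_n (fun n => Cmod (coef x n) ^ 2) N.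
Proof.
rewrite (norm_sqr_minus_sum _ _ _ Hf).
unfold Rminus; apply f_equal; unfold coef.
rewrite <- (scal_opp_one (V := R_ModuleSpace)), <- (sum_n_scal_l (V := R_ModuleSpace)).
apply sum_n_ext; intros n.
replace (inner H x (f n) - inner H x (f n))%C with (RtoC 0) by ring.
rewrite Cmod_0; unfold scal, opp, one; simpl; unfold mult; simpl; ring.
Qed.

Lemma bessel x : sqsum_le (coef x) (norm x ^ 2).
Proof.
intros N.
assert (G := norm_sqr_minus_fourier x N).
assert (G2 := pow2_ge_0 (norm (minus x (sum_n (fun n => scal (coef x n) (f n)) N)))).
lra.
Qed.

Lemma norm_sqr_sum (c : nat -> C) N :
  norm (sum_n (fun n => scal (c n) (f n)) N) ^ 2 = sum_n (fun n => Cmod (c n) ^ 2) N.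
Proof.
(* The zero vector, written so that the inner product laws evaluate it. *)
set (o := minus (f 0%nat) (f 0%nat) : H).
assert (Hi : forall y, inner H o y = RtoC 0)
  by (intros y; unfold o; rewrite inner_minus_l; ring).
assert (Hn : forall y, norm (minus o y) ^ 2 = norm o ^ 2 + norm y ^ 2).
{ intros y; apply RtoC_inj.
  rewrite RtoC_plus, <- !inner_norm, inner_minus_l, !inner_minus_r.
  rewrite (inner_conj H o y), !Hi.
  unfold Cconj, RtoC; simpl; rewrite Ropp_0; fold (RtoC 0); ring. }
assert (G := norm_sqr_minus_sum c o N Hf).
rewrite Hn in G; apply Rplus_eq_reg_l in G; rewrite G.
apply sum_n_ext; intros n.
rewrite Hi, Cmod_0; replace (c n - 0)%C with (c n) by ring.
refine (_ : @eq R _ _); ring.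
Qed.

(** By Bessel's inequality, the identity for the distance from [x] to a
    partial sum bounds the error in any one coordinate by that distance. *)
Lemma coef_series (c : nat -> C) x n :
  is_series (fun n => scal (c n) (f n)) x -> coef x n = c n.
Proof.
intros Hx; symmetry.
replace (c n) with (coef x n + (c n - coef x n))%C by ring.
rewrite (Cmod_eq_0 (c n - coef x n)%C); [ring | ].
apply Rle_antisym; [ | apply Cmod_ge_0].
apply le_epsilon; intros eps Heps; rewrite Rplus_0_l.
destruct (proj1 (is_series_norm _ _) Hx eps Heps) as [N HN].
specialize (HN (N + n)%nat (Nat.le_add_r _ _)).
apply Rle_trans with (2 := Rlt_le _ _ HN).
apply Rsqr_incr_0_var; [ | apply norm_ge_0].
rewrite !Rsqr_pow2, (norm_sqr_minus_sum _ _ _ Hf).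
assert (Hb := bessel x (N + n)%nat); unfold coef in *.
assert (Hm : forall m, (n <= m)%nat -> Cmod (c n - inner H x (f n))%C ^ 2
  - sum_n (fun i => Cmod (inner H x (f i)) ^ 2) m <=
  sum_n (fun i => Cmod (c i - inner H x (f i))%C ^ 2 - Cmod (inner H x (f i)) ^ 2) m).
{ assert (Hg : forall m, - sum_n (fun i => Cmod (inner H x (f i)) ^ 2) m <=
    sum_n (fun i => Cmod (c i - inner H x (f i))%C ^ 2 - Cmod (inner H x (f i)) ^ 2) m).
  { induction m as [ | m IHm].
    - rewrite !sum_O; nra.
    - rewrite !sum_Sn; unfold plus in *; simpl in *; nra. }
  induction m as [ | m IHm]; intros Hnm.
  - replace n with 0%nat by lia; rewrite !sum_O; lra.
  - rewrite !sum_Sn; unfold plus in *; simpl in *.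
    destruct (Nat.eq_dec n (S m)) as [-> | Hne].
    + specialize (Hg m); nra.
    + specialize (IHm ltac:(lia)); nra. }
specialize (Hm (N + n)%nat ltac:(lia)); lra.
Qed.

Lemma norm_sqr_series_le (c : nat -> C) x B :
  is_series (fun n => scal (c n) (f n)) x -> sqsum_le c B -> norm x ^ 2 <= B.
Proof.
intros Hx HB.
assert (HB0 : 0 <= B).
{ apply Rle_trans with (2 := HB 0%nat); rewrite sum_O; apply pow2_ge_0. }
rewrite <- (pow2_sqrt B) by assumption.
apply pow_incr; split; [apply norm_ge_0 | ].
apply le_epsilon; intros eps Heps.
destruct (proj1 (is_series_norm _ _) Hx eps Heps) as [N HN].
specialize (HN N (Nat.le_refl _)).
set (s := sum_n _ N) in HN.
apply Rle_trans with (1 := norm_le_minus (V := H) x s).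
assert (Hs : norm s <= sqrt B).
{ rewrite <- (sqrt_pow2 (norm s)) by apply norm_ge_0.
  apply sqrt_le_1_alt; unfold s; rewrite norm_sqr_sum; apply HB. }
lra.
Qed.

End Expansion.

(** A block of consecutive terms is a finite combination of the shifted, still
    orthonormal family, so Pythagoras transfers the Cauchy property from the
    real series of squares. *)
Lemma riesz_fischer (f : nat -> H) (c : nat -> C) B :
  orthonormal f -> sqsum_le c B -> exists x, is_series (fun n => scal (c n) (f n)) x.
Proof.
intros Hf HB; apply (ex_series_Cauchy (V := H)).
assert (Hex : ex_series (fun n => Cmod (c n) ^ 2)).
{ destruct (ex_finite_lim_seq_incr (sum_n (fun n => Cmod (c n) ^ 2)) B) as [l Hl].
  - intros n; rewrite sum_Sn; unfold plus; simpl.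
    assert (Hc := pow2_ge_0 (Cmod (c (S n)))); simpl in Hc; lra.
  - exact HB.
  - now exists l. }
intros eps.
assert (He : 0 < eps ^ 2) by apply pow_lt, cond_pos.
destruct (Cauchy_ex_series (V := R_CompleteNormedModule) _ Hex (mkposreal _ He)) as [N HN].
exists N; intros n m Hn Hm; specialize (HN n m Hn Hm).
destruct (Nat.le_gt_cases n m) as [Hnm | Hnm].
2: { rewrite sum_n_m_zero by assumption; rewrite norm_zero; apply cond_pos. }
assert (Hp : m = (n + (m - n))%nat) by lia.
set (p := (m - n)%nat) in Hp; clearbody p; subst m.
assert (HN' : Rabs (sum_n_m (fun i => Cmod (c i) ^ 2) n (n + p)) < eps ^ 2) by exact HN.
rewrite sum_n_m_shift in HN'.
apply Rle_lt_trans with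
  (norm (sum_n (fun i => scal (c (n + i)%nat) (f (n + i)%nat)) p)).
{ right; apply f_equal; exact (sum_n_m_shift (fun i => scal (c i) (f i)) n p). }
apply Rsqr_incrst_0; [ | apply norm_ge_0 | apply Rlt_le, cond_pos].
rewrite !Rsqr_pow2.
rewrite (norm_sqr_sum (f := fun i => f (n + i)%nat)).
- apply Rle_lt_trans with (2 := HN'), Rle_abs.
- destruct Hf as [H1 H0]; split; [now intros | ].
  intros i j Hij; apply H0; lia.
Qed.

(** Partial Fourier sums are best approximations and improve with their
    length, so they are eventually closer to [x] than any given element
    of the dense span. *)
Lemma fourier_series (f : nat -> H) x :
  orthonormal_basis H f -> is_series (fun n => scal (coef f x n) (f n)) x.
Proof.
intros [H1 [H0 Hd]]; assert (Hf : orthonormal f) by now split.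
apply is_series_norm; intros eps Heps.
destruct (Hd x eps Heps) as [N [c Hc]].
exists N; intros n Hn; apply Rle_lt_trans with (2 := Hc).
apply Rsqr_incr_0_var; [ | apply norm_ge_0].
rewrite !Rsqr_pow2, (norm_sqr_minus_fourier Hf), (norm_sqr_minus_sum _ _ _ Hf).
unfold Rminus; apply Rplus_le_compat_l.
fold (coef f x).
replace n with (N + (n - N))%nat by lia.
set (p := (n - N)%nat); clearbody p; clear.
induction p as [ | p IHp].
- rewrite Nat.add_0_r; induction N as [ | N IHN].
  + rewrite !sum_O; unfold coef.
    assert (G := pow2_ge_0 (Cmod (c 0%nat - inner H x (f 0%nat))%C)); lra.
  + rewrite !sum_Sn; unfold plus; simpl in *; unfold coef in *.
    assert (G := pow2_ge_0 (Cmod (c (S N) - inner H x (f (S N)))%C)); simpl in *; lra.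
- rewrite Nat.add_succ_r, sum_Sn; unfold plus; simpl in *.
  assert (G := pow2_ge_0 (Cmod (coef f x (S (N + p))))); simpl in *; lra.
Qed.

(** The operator on the space whose matrix with respect to [f] is [A]; [iota]
    picks the sum of the series. *)
Definition op (f : nat -> H) A x : H :=
  iota (fun y => is_series (fun n => scal (A (coef f x) n) (f n)) y).

Lemma is_series_op f A x : orthonormal f -> sqsum_operator A ->
  is_series (fun n => scal (A (coef f x) n) (f n)) (op f A x).
Proof.
intros Hf [_ [_ [K [_ HK]]]].
destruct (riesz_fischer Hf (HK _ _ (bessel Hf x))) as [y Hy].
apply (iota_correct (V := H)
  (fun y => is_series (fun n => scal (A (coef f x) n) (f n)) y)).
exists y; split; [exact Hy | ].
intros z Hz; exact (filterlim_locally_unique _ _ _ Hy Hz).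
Qed.

Lemma is_linear_op f A : orthonormal f -> sqsum_operator A -> is_linear (op f A).
Proof.
intros Hf HA; assert (Hop := fun x => is_series_op x Hf HA).
destruct HA as [Hadd [Hscal [K [HK0 HK]]]].
split.
- intros x y.
  apply (filterlim_locally_unique (F := eventually) _ _ _ (Hop (plus x y))).
  apply is_series_ext with (2 := is_series_plus _ _ _ _ (Hop x) (Hop y)).
  intros n; replace (A (coef f (plus x y)) n) with (A (coef f x) n + A (coef f y) n)%C.
  + symmetry; apply (scal_distr_r (V := H)).
  + rewrite <- Hadd; f_equal; apply functional_extensionality; intros i.
    symmetry; apply inner_plus_l.
- intros s x.
  apply (filterlim_locally_unique (F := eventually) _ _ _ (Hop (scal s x))).
  apply is_series_ext with (2 := is_series_scal s _ _ (Hop x)).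
  intros n; replace (A (coef f (scal s x)) n) with (s * A (coef f x) n)%C.
  + apply (scal_assoc (V := H)).
  + rewrite <- Hscal; f_equal; apply functional_extensionality; intros i.
    symmetry; apply inner_scal_l.
- exists (sqrt K); split; [now apply sqrt_lt_R0 | ].
  intros x; apply Rsqr_incr_0_var.
  + rewrite Rsqr_mult, Rsqr_sqrt, !Rsqr_pow2 by lra.
    apply (norm_sqr_series_le Hf (Hop x)), HK, bessel, Hf.
  + apply Rmult_le_pos; [apply sqrt_pos | apply norm_ge_0].
Qed.

End Hilbert.

Arguments orthonormal {k H} f.
Arguments coef {k H} f x n.
Arguments op {k H} f A x.

(** * The shift on a tridiagonal space *)

Section Tridiagonal.

Variables (k : unit_disc -> unit_disc -> C) (H : rkhs k) (a b : nat -> C).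
Variables (f : nat -> H) (M A r : R) (N0 : nat).

Let alpha n := (a n / a (S n))%C.
Let beta n := (b n / a (S n))%C.

Hypothesis a_neq0 : forall n, a n <> RtoC 0.
Hypothesis alpha_le : forall n, Cmod (alpha n) <= A.
Hypothesis beta_le : forall n, Cmod (beta n) <= M.
Hypothesis r_lt1 : 0 < r < 1.
Hypothesis beta_tail : forall n, (N0 <= n)%nat -> Cmod (beta n) <= r.
Hypothesis eval_f : forall n w, eval H (f n) w = ((a n + b n * w) * w ^ n)%C.
Hypothesis basis_f : orthonormal_basis H f.

Let ortho_f : orthonormal f.
Proof. destruct basis_f as [H1 [H0 _]]; now split. Qed.

(** The terms [c n * (a n + b n * w) * w ^ n] of the series of [x] tend to zero
    both at [w] and at [- w]; the half difference, up to the sign [(-1) ^ n],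
    isolates the part with [b n]. *)
Lemma tail_small (c : nat -> C) x (w : unit_disc) :
  is_series (fun n => scal (c n) (f n)) x ->
  forall eps, 0 < eps -> exists N, forall n, (N <= n)%nat ->
    Cmod (c n * b n * w ^ S n)%C < eps.
Proof.
intros Hx eps Heps.
assert (Hw : Cmod (- w)%C < 1) by (rewrite Cmod_opp; apply disc_lt1).
set (w' := UnitDisc (- w)%C Hw).
destruct (is_series_term_small (is_series_eval H w Hx) Heps) as [N1 HN1].
destruct (is_series_term_small (is_series_eval H w' Hx) Heps) as [N2 HN2].
exists (N1 + N2)%nat; intros n Hn.
specialize (HN1 n ltac:(lia)); specialize (HN2 n ltac:(lia)).
rewrite eval_scal, eval_f in HN1, HN2; simpl disc_val in HN2.
set (s := ((- RtoC 1) ^ n)%C).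
assert (Hs : Cmod s = 1)
  by (unfold s; now rewrite Cmod_pow, Cmod_opp, Cmod_1, pow1).
replace (- w)%C with (- RtoC 1 * w)%C in HN2 by ring.
rewrite Cpow_mult_l in HN2; fold s in HN2.
set (t1 := (c n * ((a n + b n * w) * w ^ n))%C) in HN1.
set (t2 := (c n * ((a n + b n * (- RtoC 1 * w)) * w ^ n))%C).
assert (Ht2 : Cmod t2 < eps).
{ apply Rle_lt_trans with (2 := HN2); right.
  transitivity (Cmod (s * t2)%C); [rewrite Cmod_mult, Hs; ring | ].
  f_equal; unfold t2; ring. }
replace (c n * b n * w ^ S n)%C with (/ 2 * (t1 - t2))%C.
2: { unfold t1, t2; rewrite Cpow_S; field. }
rewrite Cmod_mult, <- RtoC_inv, Cmod_R, Rabs_pos_eq by lra.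
assert (Htri := Cmod_triangle t1 (- t2)); rewrite Cmod_opp in Htri.
unfold Cminus; lra.
Qed.

(** Rearranging [c n * (a n + b n * w) * w ^ n] by powers of [w]: the partial
    sums differ only by the last term with [b n], which tends to zero. *)
Lemma taylor_series x (w : unit_disc) :
  is_series (V := C_NormedModule)
    (fun n => a n * bidiag beta (coef f x) n * w ^ n)%C (eval H x w).
Proof.
assert (Hx := fourier_series (x := x) basis_f).
set (c := coef f x) in *.
assert (Hpart : forall n, sum_n (fun n => eval H (scal (c n) (f n)) w) n =
  (sum_n (fun n => a n * bidiag beta c n * w ^ n) n + c n * b n * w ^ S n)%C).
{ induction n as [ | n IHn].
  - rewrite !sum_O, eval_scal, eval_f; refine (_ : @eq C _ _).
    unfold bidiag; simpl; ring.
  - rewrite !(sum_Sn (G := C_AbelianMonoid)), IHn, eval_scal, eval_f.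
    change (@plus C_AbelianMonoid) with Cplus; refine (_ : @eq C _ _).
    unfold bidiag, weighted_shift, beta; rewrite !Cpow_S; field; apply a_neq0. }
apply is_series_norm; intros eps Heps.
assert (He : 0 < eps / 2) by lra.
destruct (proj1 (is_series_norm _ _) (is_series_eval H w Hx) _ He) as [N1 HN1].
destruct (tail_small c w Hx He) as [N2 HN2].
exists (N1 + N2)%nat; intros n Hn.
specialize (HN1 n ltac:(lia)); specialize (HN2 n ltac:(lia)).
rewrite Hpart in HN1.
set (s := sum_n (fun n => a n * bidiag beta c n * w ^ n)%C n) in *.
set (t := (c n * b n * w ^ S n)%C) in *.
change (Cmod (eval H x w - (s + t))%C < eps / 2) in HN1.
change (Cmod (eval H x w - s)%C < eps).
replace (eval H x w - s)%C with ((eval H x w - (s + t)) + t)%C by ring.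
apply Rle_lt_trans with (1 := Cmod_triangle _ _); lra.
Qed.

(** Multiplication by [w] moves the coefficient [a n * u n] of [w ^ n] to
    [w ^ S n], and [a n = a (S n) * alpha n]. *)
Lemma eval_weighted_shift x y (w : unit_disc) :
  (forall n, bidiag beta (coef f y) n = weighted_shift alpha (bidiag beta (coef f x)) n) ->
  eval H y w = (w * eval H x w)%C.
Proof.
intros Hxy.
apply (filterlim_locally_unique (F := eventually) (V := C_NormedModule)
  _ _ _ (taylor_series y w)).
apply (is_series_decr_1 (V := C_NormedModule)).
assert (Hs := is_series_scal (V := C_NormedModule) (disc_val w) _ _ (taylor_series x w)).
replace (plus _ _) with (scal (disc_val w) (eval H x w)).
- apply is_series_ext with (2 := Hs); intros n.
  rewrite Hxy; unfold scal; simpl; unfold mult; simpl.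
  unfold alpha; field; apply a_neq0.
- rewrite Hxy; simpl weighted_shift; unfold scal, plus, opp; simpl.
  unfold mult; simpl; ring.
Qed.

Let bidiag_bounded : sqsum_operator (bidiag beta) :=
  sqsum_operator_bidiag _ beta_le.
Let bidiag_inv_bounded : sqsum_operator (bidiag_inv beta) :=
  sqsum_operator_bidiag_inv _ beta_le r_lt1 beta_tail.

(** An operator on coordinates with respect to the monomials [a n * z ^ n],
    expressed in the coordinates with respect to [f]. *)
Let conj_bidiag (B : (nat -> C) -> nat -> C) (c : nat -> C) : nat -> C :=
  bidiag_inv beta (B (bidiag beta c)).

Let conj_bidiag_bounded B : sqsum_operator B -> sqsum_operator (conj_bidiag B).
Proof.
intros HB.
apply (sqsum_operator_comp bidiag_inv_bounded (B := fun c => B (bidiag beta c))).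
exact (sqsum_operator_comp HB bidiag_bounded).
Qed.

Lemma shift_left_invertible_sufficient :
  bounded_away_from_zero (fun n => Cmod (alpha n)) -> shift_left_invertible H.
Proof.
intros [eps [Heps Hlow]].
set (gamma n := (a (S n) / a n)%C).
assert (Hgamma : forall n, Cmod (gamma n) <= / eps).
{ intros n; replace (gamma n) with (/ alpha n)%C.
  - rewrite Cmod_inv.
    2: { intros H0; specialize (Hlow n); rewrite H0, Cmod_0 in Hlow; lra. }
    apply Rinv_le_contravar; [exact Heps | apply Rlt_le, Hlow].
  - unfold gamma, alpha; field; split; apply a_neq0. }
assert (HW := conj_bidiag_bounded (sqsum_operator_weighted_shift _ alpha_le)).
assert (HX := conj_bidiag_bounded (sqsum_operator_weighted_backshift _ Hgamma)).
set (W := conj_bidiag (weighted_shift alpha)) in *.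
set (X := conj_bidiag (weighted_backshift gamma)) in *.
assert (HcW : forall x, coef f (op f W x) = W (coef f x)).
{ intros x; apply functional_extensionality; intros n.
  exact (coef_series ortho_f _ _ (is_series_op x ortho_f HW)). }
exists (op f W); split; [ | split].
- intros x w; apply eval_weighted_shift; intros n.
  rewrite HcW; apply bidiag_invK.
- exact (is_linear_op ortho_f HW).
- exists (op f X); split; [exact (is_linear_op ortho_f HX) | ].
  intros x.
  apply (filterlim_locally_unique (F := eventually) _ _ _
    (is_series_op (op f W x) ortho_f HX)).
  apply is_series_ext with (2 := fourier_series (x := x) basis_f); intros n.
  f_equal; rewrite HcW; unfold X, W, conj_bidiag.
  rewrite <- (bidiagK beta (coef f x) n).
  f_equal; apply functional_extensionality; intros i.
  unfold weighted_backshift; rewrite bidiag_invK; simpl.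
  unfold gamma, alpha; field; split; apply a_neq0.
Qed.

(** The vector [e] is the function [a m * w ^ m]; boundedness of [bidiag] gives
    the lower estimate of its norm, boundedness of [bidiag_inv] the upper. *)
Lemma monomial_exists : exists K, 0 < K /\ forall m, exists e : H,
  (forall n, bidiag beta (coef f e) n = delta m n) /\ / K <= norm e ^ 2 <= K.
Proof.
destruct bidiag_bounded as [_ [_ [K [HK0 HK]]]].
destruct bidiag_inv_bounded as [_ [_ [L [HL0 HL]]]].
exists (Rmax K L); split; [apply Rlt_le_trans with (1 := HK0), Rmax_l | intros m].
assert (Hd : sqsum_le (delta m) 1)
  by (intros n; rewrite sum_delta; destruct (Nat.leb m n); lra).
destruct (riesz_fischer ortho_f (HL _ _ Hd)) as [e He].
assert (Hc : forall n, bidiag beta (coef f e) n = delta m n).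
{ intros n; rewrite <- (bidiag_invK beta (delta m) n); f_equal.
  apply functional_extensionality; intros i; exact (coef_series ortho_f _ _ He). }
exists e; split; [exact Hc | split].
- assert (G := HK _ _ (bessel ortho_f e) m).
  rewrite (sum_n_ext _ (fun i => Cmod (delta m i) ^ 2)), sum_delta, Nat.leb_refl in G
    by (intros i; now rewrite Hc).
  apply Rle_trans with (/ K).
  + apply Rinv_le_contravar; [exact HK0 | apply Rmax_l].
  + apply Rmult_le_reg_l with K; [exact HK0 | rewrite Rinv_r by lra; exact G].
- apply Rle_trans with (2 := Rmax_r _ _).
  rewrite <- (Rmult_1_r L); exact (norm_sqr_series_le ortho_f He (HL _ _ Hd)).
Qed.

Lemma shift_left_invertible_necessary :
  shift_left_invertible H -> bounded_away_from_zero (fun n => Cmod (alpha n)).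
Proof.
intros [T [HT [_ [X [HX HXT]]]]].
destruct monomial_exists as [K [HK0 HK]].
destruct (linear_norm _ HX) as [L [HL0 HL]].
(* The ratio of the norms of two monomials is at least [/ K], and [L] bounds the
   left inverse; the factor [2] makes the inequality strict. *)
exists (/ (2 * K * L)); split; [apply Rinv_0_lt_compat; nra | intros m].
destruct (HK m) as [e [He [Hlow _]]]; destruct (HK (S m)) as [e' [He' [_ Hup]]].
assert (HTe : T e = scal (alpha m) e').
{ apply eval_inj with (r := H); intros w; rewrite HT; symmetry.
  apply eval_weighted_shift; intros n.
  transitivity (alpha m * bidiag beta (coef f e') n)%C.
  - unfold bidiag, coef; destruct n; simpl; rewrite !inner_scal_l; ring.
  - rewrite He'; destruct n as [ | n]; simpl; [unfold delta; simpl; ring | ].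
    rewrite He; unfold delta; simpl.
    destruct (Nat.eqb_spec n m) as [-> | Hne]; ring. }
assert (He2 : norm e ^ 2 <= Cmod (alpha m) ^ 2 * (L ^ 2 * norm e' ^ 2)).
{ rewrite <- (HXT e), HTe, (linear_scal _ HX), norm_sqr_scal.
  apply Rmult_le_compat_l; [apply pow2_ge_0 | ].
  rewrite <- Rpow_mult_distr; apply pow_incr; split; [apply norm_ge_0 | apply HL]. }
assert (Ha := Cmod_ge_0 (alpha m)).
apply Rnot_le_gt; intros Hle.
assert (Hsq : Cmod (alpha m) ^ 2 <= / (2 * K * L) ^ 2)
  by (rewrite <- pow_inv; apply pow_incr; split; assumption).
assert (HLK : L ^ 2 * norm e' ^ 2 <= L ^ 2 * K)
  by (apply Rmult_le_compat_l; [apply pow2_ge_0 | exact Hup]).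
assert (Hfin : norm e ^ 2 <= / (2 * K * L) ^ 2 * (L ^ 2 * K)).
{ apply Rle_trans with (1 := He2), Rmult_le_compat; try assumption.
  - apply pow2_ge_0.
  - apply Rmult_le_pos; apply pow2_ge_0. }
replace (/ (2 * K * L) ^ 2 * (L ^ 2 * K)) with (/ 4 * / K) in Hfin by (field; lra).
assert (HiK := Rinv_0_lt_compat _ HK0); lra.
Qed.

End Tridiagonal.

Lemma shift_left_invertible_iff (k : unit_disc -> unit_disc -> C) (H : rkhs k) (a b : nat -> C) :
  semi_analytic_tridiagonal H a b ->
  (shift_left_invertible H <->
     bounded_away_from_zero (fun n => Cmod (a n / a (S n)))).
Proof.
intros [_ [_ [Ha [Hsup [Hlim [f [Hf Hbasis]]]]]]].
destruct (Sup_seq_bounded _ Hsup) as [A HA].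
destruct (LimSup_seq_lt _ _ Hlim) as [r [N [Hr HN]]].
destruct (bounded_of_eventually _ HN) as [M HM].
(* A rate that is also positive, as dividing by it requires; [r] may be
   negative or zero. *)
set (s := Rmax r (/ 2)).
assert (Hs : 0 < s < 1).
{ unfold s; split; [apply Rlt_le_trans with (2 := Rmax_r _ _); lra | ].
  apply Rmax_lub_lt; lra. }
assert (HNs : forall n, (N <= n)%nat -> Cmod (b n / a (S n)) <= s)
  by (intros n Hn; apply Rle_trans with (2 := Rmax_l _ _), HN, Hn).
split.
- now apply (shift_left_invertible_necessary _ _ Ha HM Hs HNs Hf Hbasis).
- now apply (shift_left_invertible_sufficient _ _ Ha HA HM Hs HNs Hf Hbasis).
Qed.

Theorem theorem3p5 (k : unit_disc -> unit_disc -> C) (H : rkhs k) (a b : nat -> C)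
  (hpos : positive_definite k) (hana : analytic_fst k)
  (hH : semi_analytic_tridiagonal H a b) :
  (shift_left_invertible H <->
     bounded_away_from_zero (fun n => Cmod (a n / a (S n)))) /\
  (shift_left_invertible H <-> analytic_tridiagonal_space H).
Proof.
split; [now apply shift_left_invertible_iff with b | split].
- intros HT; exists a, b; split; [exact hH | ].
  now apply (shift_left_invertible_iff hH).
- intros [a' [b' [hH' Hlow]]].
  now apply (shift_left_invertible_iff hH').
Qed.
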